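(* For every $\delta\in(0,1)$ and $n\in\mathbb N$, $$M_{n,\delta}\le\delta^{-1/2}\left(1+\sqrt{\frac{n(1-\delta)}{\delta}}\right).$$
   Context: $\mathbb T$ is the unit circle, identified with $(-\pi,\pi]$ via $\theta\mapsto e^{i\theta}$. For $\delta\in(0,1)$ the Steklov class $S_\delta$ is the set of probability measures $\sigma$ on $\mathbb T$ such that $\sigma'(\theta)\ge \delta/(2\pi)$ at every Lebesgue point of $\sigma$ (equivalently a.e.), where $\sigma'$ is the density of the absolutely continuous part of $\sigma$ with respect to $d\theta$. For $\sigma\in S_\delta$, $\phi_n(z,\sigma)=\lambda_n z^n+\ldots$, $\lambda_n>0$, are the polynomials orthonormal with respect to $\sigma$: $\int_{\mathbb T}\phi_n\overline{\phi_m}\,d\sigma=\delta_{n,m}$ (Kronecker delta). Define $M_{n,\delta}=\sup_{\sigma\in S_\delta}\|\phi_n(z,\sigma)\|_{L^\infty(\mathbb T)}$. *)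

(* Defs.v *)
From mathcomp Require Import all_boot all_order all_algebra.
From mathcomp Require Import all_classical all_reals all_analysis.
From mathcomp Require Import complex.

Set Implicit Arguments.
Unset Strict Implicit.
Unset Printing Implicit Defensive.

Import Order.TTheory GRing.Theory Num.Theory.
Import numFieldNormedType.Exports.

Local Open Scope classical_set_scope.
Local Open Scope ring_scope.

(* The unit circle is parametrized by theta in ]-pi, pi] through
   theta |-> expi theta, so measures on the circle are Borel measures on R
   concentrated on [arc]. *)
Definition arc (R : realType) : set (measurableTypeR R) :=
  [set` `](- pi : R), pi]].

Arguments arc : clear implicits.

Lemma measurable_arc (R : realType) : measurable (arc R).
Proof. exact: measurable_itv. Qed.
Arguments measurable_arc : clear implicits.

Definition expi (R : realType) (theta : R) : R[i] :=
  (cos theta +i* sin theta)%C.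

Definition mutually_singular (d : measure_display) (T : measurableType d)
    (R : realType) (mu nu : {measure set T -> \bar R}) : Prop :=
  exists2 N : set T, measurable N & mu N = 0%E /\ nu (~` N) = 0%E.

(* [f] is a version of sigma', the density with respect to d theta of the
   absolutely continuous part of sigma: sigma = f d theta + nu is the Lebesgue
   decomposition of sigma, nu being its singular part. *)
Definition is_ac_density (R : realType)
    (sigma : probability (measurableTypeR R) R) (f : R -> R) : Prop :=
  [/\ measurable_fun (arc R) (f : measurableTypeR R -> measurableTypeR R),
      (forall theta, arc R theta -> 0 <= f theta) &
      exists2 nu : {measure set (measurableTypeR R) -> \bar R},
        mutually_singular (@lebesgue_measure R) nu &
        forall A : set (measurableTypeR R), measurable A ->
          sigma A = (\int[@lebesgue_measure R]_(theta in A `&` arc R)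
                       (f theta)%:E + nu A)%E].

(* Versions of sigma' agree almost everywhere, so that it does not matter for
   which of them the bound is required. *)
Definition steklov (R : realType) (delta : R)
    (sigma : probability (measurableTypeR R) R) : Prop :=
  sigma (arc R) = 1%E /\
  exists2 f : R -> R, is_ac_density sigma f &
    {ae @lebesgue_measure R,
      forall theta, arc R theta -> delta / (2 * pi) <= f theta}.

Definition Cintegral (R : realType)
    (mu : {measure set (measurableTypeR R) -> \bar R})
    (D : set (measurableTypeR R)) (f : R -> R[i]) : R[i] :=
  ((\int[mu]_(theta in D) complex.Re (f theta))
     +i* (\int[mu]_(theta in D) complex.Im (f theta)))%C.

(* In R[i], 0 < z means that z is real and positive. *)
Definition orthonormal_polys (R : realType)
    (sigma : probability (measurableTypeR R) R)
    (phi : nat -> {poly R[i]}) : Prop :=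
  (forall n, size (phi n) = n.+1 /\ 0 < lead_coef (phi n)) /\
  (forall n m,
     Cintegral sigma (arc R) (fun theta =>
       (phi n).[expi theta] * conjc (phi m).[expi theta]) = (n == m)%:R).

Definition Linfty_circle (R : realType) (p : {poly R[i]}) : \bar R :=
  ('N[mrestr (@lebesgue_measure R) (measurable_arc R)]_(+oo)
     [(fun theta : R => (Normc.normc p.[expi theta])%:E)])%E.

(* M_{n,delta}, where phi_n(., sigma) is the n-th term of the (unique)
   orthonormal sequence of sigma. *)
Definition steklov_sup (R : realType) (n : nat) (delta : R) : \bar R :=
  ereal_sup [set x | exists sigma phi,
    [/\ steklov delta sigma, orthonormal_polys sigma phi &
        x = Linfty_circle (phi n)]].

(* Main.v *)
Require Import Defs.
From mathcomp Require Import all_boot all_order all_algebra.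
From mathcomp Require Import all_classical all_reals all_analysis.
From mathcomp Require Import measurable_realfun ess_sup_inf.
From mathcomp Require Import complex ring lra.

Import Order.TTheory GRing.Theory Num.Theory.
Import numFieldNormedType.Exports.
Local Open Scope classical_set_scope.
Local Open Scope ring_scope.

Set Implicit Arguments.
Unset Strict Implicit.
Unset Printing Implicit Defensive.

(** Write phi_n = l z^n + sum over j < n of a_j z^j and fix sigma in the Steklov
    class. Two facts about the coefficients suffice.

    - [lead_coef_orthonormal_ge1]: l >= 1. The polynomial phi_n is orthogonal to
      all polynomials of degree below n, so by Pythagoras phi_n is the shortest
      polynomial of degree n with leading coefficient l; it is therefore no longer
      than l z^n, whose norm is l because sigma is a probability.
    - [sum_normc_coef_le]: delta (l^2 + sum |a_j|^2) <= 1. Indeed sigma dominates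
      delta / (2 pi) times Lebesgue measure on the arc ([steklov_ge_integral]), so
      the integral of |phi_n|^2 against sigma, which is 1, is at least delta times
      its normalized Lebesgue integral, which [parseval] computes.

    Hence l <= delta^(-1/2) and sum |a_j|^2 <= 1/delta - 1 = (1 - delta)/delta. On
    the circle |phi_n| <= l + sum |a_j|, and Cauchy-Schwarz on the n lower
    coefficients yields

      |phi_n| <= delta^(-1/2) + sqrt (n (1 - delta) / delta),

    which implies the claimed bound since delta^(-1/2) >= 1. *)

(* In what follows [arc] is the parametrizing interval ]-pi, pi], not the arc of a
   cyclic sequence. *)
Local Notation arc := Defs.arc.

(** * Points of the circle *)

Lemma expiM_conj (R : realType) (x : R) : expi x * conjc (expi x) = 1.
Proof.
rewrite /expi; apply/eqP; rewrite eq_complex /= !mulrN opprK -!expr2.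
by rewrite cos2Dsin2 eqxx mulrC addNr eqxx.
Qed.

Lemma expi_exp (R : realType) (x : R) n : expi x ^+ n = expi (n%:R * x).
Proof.
elim: n => [|n IH]; first by rewrite mul0r /expi cos0 sin0.
rewrite exprS IH -natr1 mulrDl mul1r addrC /expi cosD sinD.
by apply/eqP; rewrite eq_complex /= eqxx /=; apply/eqP; ring.
Qed.

Lemma normc_expi_exp (R : realType) (x : R) n : Normc.normc (expi x ^+ n) = 1.
Proof. by rewrite expi_exp /= cos2Dsin2 sqrtr1. Qed.

Lemma normc_horner_expi_le (R : realType) (p : {poly R[i]}) (x : R) :
  Normc.normc p.[expi x] <= \sum_(i < size p) Normc.normc p`_i.
Proof.
rewrite horner_coef; elim/big_ind2: _ => [|u a v b ua vb|i _].
- by rewrite Normc.normc0.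
- by rewrite (le_trans (le_normcD _ _)) // lerD.
- by rewrite Normc.normcM normc_expi_exp mulr1.
Qed.

(** * Integrals over the circle *)

(** Stated through real and imaginary parts because that is how [Cintegral]
    reads a function. *)
Definition ccontinuous {R : realType} (f : R -> R[i]) : Prop :=
  continuous (fun x : R => complex.Re (f x) : R) /\
  continuous (fun x : R => complex.Im (f x) : R).

Lemma ccontinuous_cst (R : realType) (c : R[i]) : ccontinuous (fun _ : R => c).
Proof. by split; apply: cst_continuous. Qed.

Lemma ccontinuousD (R : realType) (f g : R -> R[i]) :
  ccontinuous f -> ccontinuous g -> ccontinuous (fun x => f x + g x).
Proof.
move=> [f1 f2] [g1 g2]; split.
- rewrite (_ : (fun x => _) = (fun x => complex.Re (f x) + complex.Re (g x))).
    by move=> x; apply: cvgD; [exact: f1|exact: g1].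
  by apply/funext => x; case: (f x) => ? ?; case: (g x).
- rewrite (_ : (fun x => _) = (fun x => complex.Im (f x) + complex.Im (g x))).
    by move=> x; apply: cvgD; [exact: f2|exact: g2].
  by apply/funext => x; case: (f x) => ? ?; case: (g x).
Qed.

Lemma ccontinuousM (R : realType) (f g : R -> R[i]) :
  ccontinuous f -> ccontinuous g -> ccontinuous (fun x => f x * g x).
Proof.
move=> [f1 f2] [g1 g2]; split.
- rewrite (_ : (fun x => _) = (fun x => complex.Re (f x) * complex.Re (g x)
                                  - complex.Im (f x) * complex.Im (g x))).
    move=> x; apply: cvgB; apply: cvgM; [exact: f1|exact: g1|exact: f2|exact: g2].
  by apply/funext => x; case: (f x) => ? ?; case: (g x).
- rewrite (_ : (fun x => _) = (fun x => complex.Re (f x) * complex.Im (g x)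
                                  + complex.Im (f x) * complex.Re (g x))).
    move=> x; apply: cvgD; apply: cvgM; [exact: f1|exact: g2|exact: f2|exact: g1].
  by apply/funext => x; case: (f x) => ? ?; case: (g x).
Qed.

Lemma ccontinuous_conj (R : realType) (f : R -> R[i]) :
  ccontinuous f -> ccontinuous (fun x => conjc (f x)).
Proof.
move=> [f1 f2]; split.
- rewrite (_ : (fun x => _) = (fun x => complex.Re (f x))) //.
  by apply/funext => x; case: (f x).
- rewrite (_ : (fun x => _) = (fun x => - complex.Im (f x))).
    by move=> x; apply: cvgN; exact: f2.
  by apply/funext => x; case: (f x).
Qed.

Lemma ccontinuous_horner_expi (R : realType) (p : {poly R[i]}) :
  ccontinuous (fun theta : R => p.[expi theta]).
Proof.
elim/poly_ind: p => [|p c IH].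
  rewrite (_ : (fun _ => _) = (fun _ => 0)); first exact: ccontinuous_cst.
  by apply/funext => x; rewrite horner0.
rewrite (_ : (fun _ => _) = (fun x : R => p.[expi x] * expi x + c)); last first.
  by apply/funext => x; rewrite hornerMXaddC.
apply: ccontinuousD; last exact: ccontinuous_cst.
by apply: ccontinuousM => //; split; [exact: continuous_cos|exact: continuous_sin].
Qed.

(** A continuous function is bounded on the closed arc, hence on the half-open
    one; this is the only source of integrability in the proof. *)
Lemma arc_integrable (R : realType)
    (mu : {measure set (measurableTypeR R) -> \bar R}) (f : R -> R) :
  (mu (arc R) < +oo)%E -> continuous f -> mu.-integrable (arc R) (EFin \o f).
Proof.
move=> mufin cf; apply: measurable_bounded_integrable => //.
- exact: measurable_arc.
- by apply: measurable_funTS; exact: continuous_measurable_fun.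
- have cfI : {within `[- pi, pi], continuous f} by exact: continuous_subspaceT.
  have /compact_bounded[M [Mr Mf]] := continuous_compact cfI (@segment_compact R _ _).
  exists M; split => // y My x /= xarc; apply: (Mf y My).
  by exists x => //; exact: subset_itv_oc_cc xarc.
Qed.

Section Cintegral.
Variables (R : realType) (mu : {measure set (measurableTypeR R) -> \bar R}).
Hypothesis mufin : (mu (arc R) < +oo)%E.

Lemma CintegralD (f g : R -> R[i]) : ccontinuous f -> ccontinuous g ->
  Cintegral mu (arc R) (fun x => f x + g x) =
  Cintegral mu (arc R) f + Cintegral mu (arc R) g.
Proof.
move=> [f1 f2] [g1 g2]; rewrite /Cintegral.
have marc := @measurable_arc R.
transitivity (((\int[mu]_(x in arc R) (complex.Re (f x) + complex.Re (g x)))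
  +i* (\int[mu]_(x in arc R) (complex.Im (f x) + complex.Im (g x))))%C).
  by congr Complex; apply: eq_Rintegral => x _; case: (f x) => ? ?; case: (g x).
by rewrite !RintegralD //; exact: arc_integrable.
Qed.

Lemma CintegralZ (c : R[i]) (f : R -> R[i]) : ccontinuous f ->
  Cintegral mu (arc R) (fun x => c * f x) = c * Cintegral mu (arc R) f.
Proof.
case: c => a b [f1 f2]; rewrite /Cintegral.
have marc := @measurable_arc R.
have iRe := arc_integrable mufin f1; have iIm := arc_integrable mufin f2.
have iZ (k : R) (g : R -> R) : continuous g ->
    mu.-integrable (arc R) (EFin \o (fun x => k * g x)).
  by move=> cg; apply: arc_integrable => // x; apply: cvgMl_tmp; exact: cg.
transitivity (((\int[mu]_(x in arc R) (a * complex.Re (f x) - b * complex.Im (f x)))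
  +i* (\int[mu]_(x in arc R) (a * complex.Im (f x) + b * complex.Re (f x))))%C).
  by congr Complex; apply: eq_Rintegral => x _; case: (f x).
by rewrite RintegralB ?RintegralD ?RintegralZl //; exact: iZ.
Qed.

Lemma Cintegral_conj (f : R -> R[i]) : ccontinuous f ->
  Cintegral mu (arc R) (fun x => conjc (f x)) = conjc (Cintegral mu (arc R) f).
Proof.
move=> [f1 f2]; rewrite /Cintegral /=.
have marc := @measurable_arc R.
rewrite -mulN1r -RintegralZl //; last exact: arc_integrable.
by congr Complex; apply: eq_Rintegral => x _; case: (f x) => // u v /=; rewrite mulN1r.
Qed.

End Cintegral.

(** * The Gram form of a measure on the circle *)

Definition circle_form (R : realType)
    (mu : {measure set (measurableTypeR R) -> \bar R}) (p q : {poly R[i]}) : R[i] :=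
  Cintegral mu (arc R) (fun theta => p.[expi theta] * conjc q.[expi theta]).

Lemma ccontinuous_circle_form (R : realType) (p q : {poly R[i]}) :
  ccontinuous (fun theta : R => p.[expi theta] * conjc q.[expi theta]).
Proof.
apply: ccontinuousM; first exact: ccontinuous_horner_expi.
by apply: ccontinuous_conj; exact: ccontinuous_horner_expi.
Qed.

Section CircleForm.
Variables (R : realType) (mu : {measure set (measurableTypeR R) -> \bar R}).
Hypothesis mufin : (mu (arc R) < +oo)%E.
Implicit Types p q : {poly R[i]}.

Lemma circle_formD p1 p2 q :
  circle_form mu (p1 + p2) q = circle_form mu p1 q + circle_form mu p2 q.
Proof.
rewrite /circle_form -CintegralD //; try exact: ccontinuous_circle_form.
by congr Cintegral; apply/funext => x; rewrite hornerD mulrDl.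
Qed.

Lemma circle_formZ c p q : circle_form mu (c *: p) q = c * circle_form mu p q.
Proof.
rewrite /circle_form -CintegralZ //; try exact: ccontinuous_circle_form.
by congr Cintegral; apply/funext => x; rewrite hornerZ mulrA.
Qed.

Lemma circle_form0 q : circle_form mu 0 q = 0.
Proof. by rewrite -(scale0r 0) circle_formZ mul0r. Qed.

Lemma circle_form_sum n (P : 'I_n -> {poly R[i]}) q :
  circle_form mu (\sum_(i < n) P i) q = \sum_(i < n) circle_form mu (P i) q.
Proof.
apply: (big_morph (fun p => circle_form mu p q)) => [p1 p2|].
- exact: circle_formD.
- exact: circle_form0.
Qed.

Lemma circle_formC p q : circle_form mu q p = conjc (circle_form mu p q).
Proof.
rewrite /circle_form -Cintegral_conj //; last exact: ccontinuous_circle_form.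
by congr Cintegral; apply/funext => x; rewrite rmorphM /= conjcK mulrC.
Qed.

Lemma circle_form_pythagoras p q : circle_form mu p q = 0 ->
  circle_form mu (p + q) (p + q) = circle_form mu p p + circle_form mu q q.
Proof.
move=> pq0; have qp0 : circle_form mu q p = 0 by rewrite circle_formC pq0 conjc0.
rewrite circle_formD (circle_formC (p + q) p) (circle_formC (p + q) q).
rewrite !circle_formD pq0 qp0 addr0 add0r.
by rewrite -(circle_formC p p) -(circle_formC q q).
Qed.

Lemma circle_form_normc p :
  circle_form mu p p =
  (\int[mu]_(theta in arc R) (Normc.normc p.[expi theta] ^+ 2))%:C%C.
Proof.
rewrite /circle_form /Cintegral; congr Complex.
- apply: eq_Rintegral => x _; case: (p.[_]) => a b /=.
  by rewrite sqr_sqrtr ?addr_ge0 ?sqr_ge0 // mulrN opprK !expr2.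
- rewrite (@eq_Rintegral _ _ _ _ _ (cst 0)) ?Rintegral_cst ?mul0r //.
    exact: measurable_arc.
  by move=> x _; case: (p.[_]) => a b /=; ring.
Qed.

Lemma circle_form_ge0 p : 0 <= circle_form mu p p.
Proof.
rewrite circle_form_normc lecR; apply: Rintegral_ge0 => x _; exact: sqr_ge0.
Qed.

Lemma circle_form_Xn n : mu (arc R) = 1%E -> circle_form mu 'X^n 'X^n = 1.
Proof.
move=> mu1; rewrite circle_form_normc.
rewrite (@eq_Rintegral _ _ _ _ _ (cst 1)).
  by rewrite Rintegral_cst ?mu1 ?mul1r //; exact: measurable_arc.
move=> x _; rewrite hornerXn /= -[LHS]/(Normc.normc (expi x ^+ n) ^+ 2).
by rewrite normc_expi_exp expr1n.
Qed.

End CircleForm.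

(** * Parseval identity *)

Lemma sin_npi (R : realType) n : sin (n%:R * pi : R) = 0.
Proof.
elim: n => [|n IH]; first by rewrite mul0r sin0.
by rewrite -natr1 mulrDl mul1r sinDpi IH oppr0.
Qed.

Lemma lebesgue_arc (R : realType) :
  (@lebesgue_measure R (arc R) = (2 * pi)%:E)%E.
Proof.
have Nlt : - pi < pi :> R by have := pi_gt0 R; lra.
rewrite lebesgue_measure_itv /= lte_fin Nlt -EFinD; congr (_%:E); ring.
Qed.

Lemma lebesgue_arc_fin (R : realType) : (@lebesgue_measure R (arc R) < +oo)%E.
Proof. by rewrite lebesgue_arc ltry. Qed.

(** The arc is half-open, but its missing endpoint is Lebesgue-null. *)
Lemma integral_arc_FTC (R : realType) (f F : R -> R) :
  continuous f -> (forall x : R, is_derive x 1 F (f x)) ->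
  \int[@lebesgue_measure R]_(x in arc R) f x = F pi - F (- pi).
Proof.
move=> cf dF.
have Nlt : - pi < pi :> R by have := pi_gt0 R; lra.
have cF : continuous F.
  by move=> x; apply/differentiable_continuous/derivable1_diffP; case: (dF x).
rewrite Rintegral_itv_obnd_cbnd; last first.
  by apply: arc_integrable => //; exact: lebesgue_arc_fin.
rewrite /Rintegral (@continuous_FTC2 _ f F) //.
- exact: continuous_subspaceT.
- split => [x _||]; first by case: (dF x).
  + by apply: cvg_at_right_filter; exact: cF.
  + by apply: cvg_at_left_filter; exact: cF.
- by move=> x _; rewrite derive1E; case: (dF x).
Qed.

Lemma Cintegral_expi_exp (R : realType) (n : nat) : (0 < n)%N ->
  Cintegral (@lebesgue_measure R) (arc R) (fun x => expi x ^+ n) = 0.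
Proof.
move=> n0; have n0' : n%:R != 0 :> R by rewrite pnatr_eq0 -lt0n.
have dn (x : R) : is_derive x 1 (fun y : R => n%:R * y) n%:R.
  by apply: is_derive_eq; rewrite scaler1.
have cn : continuous (fun y : R => n%:R * y).
  by move=> x; apply: cvgMl_tmp; exact: cvg_id.
have ccos : continuous (fun x : R => cos (n%:R * x)).
  by move=> x; apply: continuous_comp; [exact: cn|exact: continuous_cos].
have csin : continuous (fun x : R => sin (n%:R * x)).
  by move=> x; apply: continuous_comp; [exact: cn|exact: continuous_sin].
have dsin (x : R) :
    is_derive x 1 (fun y : R => n%:R^-1 * sin (n%:R * y)) (cos (n%:R * x)).
  by apply: is_derive_eq; rewrite /= /GRing.scale /=; field.
have dcos (x : R) :
    is_derive x 1 (fun y : R => - n%:R^-1 * cos (n%:R * y)) (sin (n%:R * x)).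
  by apply: is_derive_eq; rewrite /= /GRing.scale /=; field.
rewrite /Cintegral; congr Complex.
- transitivity (\int[@lebesgue_measure R]_(x in arc R) cos (n%:R * (x : R))).
    by apply: eq_Rintegral => x _; rewrite expi_exp.
  by rewrite (integral_arc_FTC ccos dsin) mulrN sinN sin_npi; ring.
- transitivity (\int[@lebesgue_measure R]_(x in arc R) sin (n%:R * (x : R))).
    by apply: eq_Rintegral => x _; rewrite expi_exp.
  by rewrite (integral_arc_FTC csin dcos) mulrN cosN; ring.
Qed.

(** Conjugate symmetry lets one assume k <= j; then z^j times the conjugate of
    z^k is z^(j-k) on the circle, a natural power. *)
Lemma circle_form_lebesgue_Xn (R : realType) (j k : nat) :
  circle_form (@lebesgue_measure R) 'X^j 'X^k = ((2 * pi) *+ (j == k))%:C%C.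
Proof.
wlog kj : j k / (k <= j)%N.
  move=> H; case: (leqP k j) => [|/ltnW] kj; first exact: H.
  by rewrite (circle_formC (lebesgue_arc_fin R)) H // conjc_real eq_sym.
have XX (x : R) : 'X^j.[expi x] * conjc 'X^k.[expi x] = expi x ^+ (j - k).
  rewrite !hornerXn -{1}(subnK kj) exprD -mulrA rmorphXn /= -exprMn.
  by rewrite expiM_conj expr1n mulr1.
rewrite /circle_form (_ : (fun _ => _) = (fun x => expi x ^+ (j - k))); last first.
  by apply/funext => x; exact: XX.
have [->|jk] := eqVneq j k.
  rewrite subnn mulr1n /Cintegral; congr Complex.
  - rewrite Rintegral_cst; last exact: measurable_arc.
    by rewrite mul1r; exact: (congr1 fine (lebesgue_arc R)).
  - by rewrite Rintegral_cst ?mul0r //; exact: measurable_arc.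
rewrite Cintegral_expi_exp ?mulr0n //.
by rewrite subn_gt0 ltn_neqAle eq_sym jk.
Qed.

Lemma parseval (R : realType) (p : {poly R[i]}) :
  circle_form (@lebesgue_measure R) p p =
  (2 * pi * \sum_(i < size p) Normc.normc p`_i ^+ 2)%:C%C.
Proof.
have fin := lebesgue_arc_fin R.
have pE : p = \sum_(i < size p) p`_i *: 'X^i by rewrite -poly_def coefK.
have coefE (j : 'I_(size p)) :
    circle_form (@lebesgue_measure R) p 'X^j = p`_j * (2 * pi)%:C%C.
  rewrite {1}pE circle_form_sum // (bigD1 j) //= big1 => [|i ij].
    by rewrite circle_formZ // circle_form_lebesgue_Xn eqxx mulr1n addr0.
  rewrite circle_formZ // circle_form_lebesgue_Xn.
  by rewrite (inj_eq val_inj) (negbTE ij) mulr0n mulr0.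
rewrite {1}pE circle_form_sum // mulr_sumr rmorph_sum; apply: eq_bigr => i _.
rewrite circle_formZ // circle_formC // coefE.
case: (p`_i) => a b /=; apply/eqP; rewrite eq_complex /=.
by rewrite sqr_sqrtr ?addr_ge0 ?sqr_ge0 //; apply/andP; split; apply/eqP; ring.
Qed.

(** * The leading coefficient of an orthonormal polynomial *)

Lemma size_sub_lead_Xn (F : fieldType) (p : {poly F}) n : size p = n.+1 ->
  (size (p - lead_coef p *: 'X^n)%R <= n)%N.
Proof.
move=> sp; apply/leq_sizeP => j nj; rewrite coefB coefZ coefXn lead_coefE sp /=.
have [->|jn] := eqVneq j n; first by rewrite mulr1 subrr.
by rewrite mulr0 subr0 nth_default // sp ltn_neqAle eq_sym jn.
Qed.

Section Orthonormal.
Variables (R : realType) (sigma : probability (measurableTypeR R) R).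
Variable phi : nat -> {poly R[i]}.
Hypothesis sigma1 : sigma (arc R) = 1%E.
Hypothesis phi_on : orthonormal_polys sigma phi.

Let sigmafin : (sigma (arc R) < +oo)%E.
Proof. by rewrite sigma1 ltry. Qed.

(** phi_0, ..., phi_(n-1) have degrees 0, ..., n-1 and so span the polynomials of
    degree below n: subtracting a multiple of phi_m from q lowers its degree. *)
Lemma circle_form_low_degree n (q : {poly R[i]}) : (size q <= n)%N ->
  circle_form sigma q (phi n) = 0.
Proof.
have [phi_deg phi_orth] := phi_on.
(* Separate the degree bound m, on which the induction runs, from n. *)
have : (n <= n)%N by [].
move: {1 3}n => m; elim: m => [|m IH] in q *.
  by move=> _; rewrite leqn0 size_poly_eq0 => /eqP ->; exact: circle_form0.
move=> mn sq; have [sm lm] := phi_deg m.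
have [sqm|sqm] := leqP (size q) m; first by apply: IH => //; exact: ltnW.
have sqE : size q = m.+1 by apply/eqP; rewrite eqn_leq sq.
pose c := lead_coef q / lead_coef (phi m).
have -> : q = (q - c *: phi m) + c *: phi m by rewrite subrK.
rewrite circle_formD // circle_formZ //.
rewrite [circle_form _ (phi m) _]phi_orth (ltn_eqF mn) mulr0 addr0.
apply: IH; first exact: ltnW.
have -> : q - c *: phi m = (q - lead_coef q *: 'X^m)
    - c *: (phi m - lead_coef (phi m) *: 'X^m).
  by rewrite scalerBr scalerA divfK ?gt_eqF // opprB addrA subrK.
rewrite (leq_trans (size_polyD _ _)) // geq_max size_sub_lead_Xn //=.
by rewrite size_polyN (leq_trans (size_scale_leq _ _)) // size_sub_lead_Xn.
Qed.

(** The monic polynomial phi_n / l, with l the leading coefficient, minimizes the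
    norm among monic polynomials of degree n, and z^n has norm 1 because sigma is
    a probability. Concretely, l z^n = r + phi_n with r of degree below n, hence
    orthogonal to phi_n, so Pythagoras gives l^2 = |r|^2 + 1. *)
Lemma lead_coef_orthonormal_ge1 n : 1 <= lead_coef (phi n).
Proof.
have [phi_deg phi_orth] := phi_on; have [sn l0] := phi_deg n.
set l := lead_coef (phi n) in l0 *.
pose r := l *: 'X^n - phi n.
have sr : (size r <= n)%N by rewrite -size_polyN opprB size_sub_lead_Xn.
have r0 := circle_form_low_degree sr.
have lXE : l *: 'X^n = r + phi n by rewrite subrK.
have : circle_form sigma (l *: 'X^n) (l *: 'X^n) = circle_form sigma r r + 1.
  rewrite lXE circle_form_pythagoras //; congr (_ + _).
  by have := phi_orth n n; rewrite eqxx.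
rewrite circle_formZ // circle_formC // circle_formZ // circle_form_Xn // mulr1.
have lJ : conjc l = l.
  by move: l0; clear; case: l => a b; rewrite ltcE /= => /andP[/eqP -> _]; rewrite oppr0.
rewrite lJ -expr2 => lE.
have : 1 <= l ^+ 2 by rewrite lE lerDr circle_form_ge0.
by rewrite expr_ge1 // ltW.
Qed.

End Orthonormal.

(** * Comparison of a Steklov measure with Lebesgue measure *)

Lemma steklov_ge_measure (R : realType) (delta : R)
    (sigma : probability (measurableTypeR R) R) (A : set (measurableTypeR R)) :
  0 <= delta -> steklov delta sigma -> measurable A ->
  ((delta / (2 * pi))%:E * @lebesgue_measure R (A `&` arc R) <= sigma A)%E.
Proof.
move=> d0 [_ [f [mf f0 [nu _ sigmaE]] aef]] mA; rewrite sigmaE //.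
have k0 : 0 <= delta / (2 * pi) by rewrite divr_ge0 // mulr_ge0 // pi_ge0.
have mAa : measurable (A `&` arc R) by apply: measurableI => //; exact: measurable_arc.
apply: (@le_trans _ _ (\int[@lebesgue_measure R]_(theta in A `&` arc R) (f theta)%:E)%E);
  last by rewrite leeDl.
rewrite -integral_cst //; apply: ae_ge0_le_integral => //.
- by move=> x [_ ax]; rewrite lee_fin f0.
- apply/measurable_EFinP; apply: measurable_funS mf => //; exact: measurable_arc.
- by apply: filterS aef => x H [_ ax]; rewrite lee_fin H.
Qed.

(** The comparison of sets holds inside the arc only, whereas comparing integrals
    through measures asks for an inequality on all measurable sets. Adding to
    sigma the multiple of Lebesgue measure carried by the complement of the arc
    repairs this, and changes no integral over the arc. *)
Lemma steklov_ge_integral (R : realType) (delta : R)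
    (sigma : probability (measurableTypeR R) R) (g : R -> R) :
  0 <= delta -> steklov delta sigma -> continuous g -> (forall x, 0 <= g x) ->
  delta / (2 * pi) * (\int[@lebesgue_measure R]_(x in arc R) g x) <=
  \int[sigma]_(x in arc R) g x.
Proof.
move=> d0 ssigma cg g0.
have k0 : 0 <= delta / (2 * pi) by rewrite divr_ge0 // mulr_ge0 // pi_ge0.
have marc := measurable_arc R.
have marcC : measurable (~` arc R) by exact: measurableC.
have mg : measurable_fun [set: measurableTypeR R] (EFin \o g).
  by apply/measurable_EFinP; exact: continuous_measurable_fun.
pose K := NngNum k0.
pose leb := @lebesgue_measure R : {measure set (measurableTypeR R) -> \bar R}.
pose m1 : {measure set (measurableTypeR R) -> \bar R} := mscale K leb.
pose m0 : {measure set (measurableTypeR R) -> \bar R} := mscale K (mrestr leb marcC).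
pose m2 : {measure set (measurableTypeR R) -> \bar R} := measure_add sigma m0.
have m12 (S : set (measurableTypeR R)) : measurable S -> (m1 S <= m2 S)%E.
  move=> mS; have -> : m2 S = (sigma S + m0 S)%E by exact: measure_addE.
  rewrite /m1 /m0 /mscale /= /mrestr.
  rewrite -[in leLHS](setIT S) -(setUv (arc R)) setIUr measureU; last first.
  - by rewrite setIACA setICr setI0.
  - exact: measurableI.
  - exact: measurableI.
  by apply: leeD; [exact: steklov_ge_measure|exact: lexx].
have /(_ marc) := @ge0_le_measure_integral _ _ _ _ _ m12 (EFin \o g) (arc R).
move=> /(_ (fun x => g0 x) mg).
have mga : measurable_fun (arc R) (EFin \o g) by exact: measurable_funTS.
rewrite /m2 ge0_integral_measure_add //; last by move=> x _; rewrite lee_fin.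
have m0arc : m0 (arc R) = 0%E.
  rewrite (_ : m0 _ = K%:num%:E * leb (arc R `&` ~` arc R))%E //.
  by rewrite setICr measure0 mule0.
rewrite [X in (_ + X)%E]null_set_integral //.
rewrite adde0 ge0_integral_mscale //; last by move=> x _; rewrite lee_fin.
have i1 := integrable_fin_num marc (arc_integrable (lebesgue_arc_fin R) cg).
have sfin : (sigma (arc R) < +oo)%E by case: ssigma => -> _; rewrite ltry.
have i2 := integrable_fin_num marc (arc_integrable sfin cg).
move=> H; rewrite /Rintegral -lee_fin EFinM (fineK i1) (fineK i2).
exact: H.
Qed.

(** * The pointwise bound *)

(** Cauchy-Schwarz against the constant 1, by summing
    x_i x_j <= (x_i^2 + x_j^2) / 2 over all pairs. *)
Lemma sqr_sum_le (R : realFieldType) n (x : 'I_n -> R) :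
  (\sum_(i < n) x i) ^+ 2 <= n%:R * \sum_(i < n) x i ^+ 2.
Proof.
have -> : n%:R * \sum_(i < n) x i ^+ 2 =
    \sum_(i < n) \sum_(j < n) (x i ^+ 2 + x j ^+ 2) / 2.
  transitivity (\sum_(i < n) (n%:R * x i ^+ 2 + \sum_(j < n) x j ^+ 2) / 2).
    rewrite -mulr_suml big_split /= -mulr_sumr sumr_const card_ord -mulr_natl.
    by field.
  apply: eq_bigr => i _; rewrite -[in RHS]mulr_suml big_split /=.
  by rewrite sumr_const card_ord mulr_natl.
rewrite expr2 mulr_suml; apply: ler_sum => i _; rewrite mulr_sumr.
by apply: ler_sum => j _; have := sqr_ge0 (x i - x j); nra.
Qed.

(** The left side is delta / (2 pi) times the integral of |p|^2 over the arc, by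
    Parseval, and the right side is the integral of |p|^2 against sigma. *)
Lemma sum_normc_coef_le (R : realType) (delta : R)
    (sigma : probability (measurableTypeR R) R) (p : {poly R[i]}) :
  0 <= delta -> steklov delta sigma -> circle_form sigma p p = 1 ->
  delta * \sum_(i < size p) Normc.normc p`_i ^+ 2 <= 1.
Proof.
move=> d0 ssigma p1.
pose g (x : R) := Normc.normc p.[expi x] ^+ 2.
have [cRe cIm] := ccontinuous_horner_expi p.
have cg : continuous g.
  rewrite (_ : g = (fun x => complex.Re p.[expi x] * complex.Re p.[expi x]
                         + complex.Im p.[expi x] * complex.Im p.[expi x])).
    by move=> x; apply: cvgD; apply: cvgM; [exact: cRe|exact: cRe|exact: cIm|exact: cIm].
  apply/funext => x; rewrite /g; case: (p.[_]) => a b /=.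
  by rewrite sqr_sqrtr ?addr_ge0 ?sqr_ge0 // !expr2.
have := steklov_ge_integral d0 ssigma cg (fun x => sqr_ge0 _).
have := parseval p; rewrite circle_form_normc => /(congr1 (@complex.Re R)) /= ->.
move: p1; rewrite circle_form_normc => /(congr1 (@complex.Re R)) /= ->.
have pi0 : pi != 0 :> R by rewrite gt_eqF // pi_gt0.
by rewrite mulrA divfK // mulf_neq0 // pnatr_eq0.
Qed.

(** The squared moduli of the coefficients add up to at most 1 / delta. The leading
    one is at least 1, which leaves at most (1 - delta) / delta for the n lower
    ones, and Cauchy-Schwarz bounds the sum of their moduli. *)
Lemma orthonormal_normc_le (R : realType) (delta : R)
    (sigma : probability (measurableTypeR R) R) (phi : nat -> {poly R[i]})
    (n : nat) (x : R) :
  0 < delta -> steklov delta sigma -> orthonormal_polys sigma phi ->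
  Normc.normc (phi n).[expi x] <=
    Num.sqrt delta^-1 + Num.sqrt (n%:R * (1 - delta) / delta).
Proof.
move=> d0 ssigma phi_on; have [sigma1 _] := ssigma.
have [phi_deg phi_orth] := phi_on.
have [sn _] := phi_deg n.
have p1 : circle_form sigma (phi n) (phi n) = 1.
  by have := phi_orth n n; rewrite eqxx.
have lead1 := lead_coef_orthonormal_ge1 sigma1 phi_on n.
have dLQ := sum_normc_coef_le (ltW d0) ssigma p1.
apply: le_trans (normc_horner_expi_le _ _) _.
move: lead1 dLQ; rewrite lead_coefE sn !big_ord_recr /=.
set L := Normc.normc (phi n)`_n; set Q := \sum_(i < n) _; set S := \sum_(i < n) _.
move=> lead1 dLQ.
have L1 : 1 <= L.
  move: lead1; rewrite /L; case: ((phi n)`_n) => a b.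
  rewrite lecE /= => /andP[/eqP -> a1].
  by rewrite expr0n /= addr0 sqrtr_sqr ger0_norm // (le_trans ler01).
have Q0 : 0 <= Q by apply: sumr_ge0 => i _; exact: sqr_ge0.
have SQ : S ^+ 2 <= n%:R * Q by exact: sqr_sum_le.
have L2 : L ^+ 2 <= delta^-1.
  rewrite -[leRHS]mul1r ler_pdivlMr // mulrC.
  have := mulr_ge0 (ltW d0) Q0; lra.
have Q2 : Q <= (1 - delta) / delta.
  rewrite ler_pdivlMr //.
  have : delta * 1 <= delta * L ^+ 2.
    by rewrite ler_pM2l // expr_ge1 // (le_trans ler01).
  lra.
rewrite addrC lerD //.
  by rewrite -[leLHS]ger0_norm ?(le_trans ler01) // -sqrtr_sqr ler_wsqrtr.
rewrite (le_trans (ler_norm S)) // -sqrtr_sqr ler_wsqrtr //.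
by rewrite (le_trans SQ) // -mulrA ler_wpM2l.
Qed.

Theorem lemma0p2 (R : realType) (delta : R) (n : nat)
    (delta_gt0 : 0 < delta) (delta_lt1 : delta < 1) :
  (steklov_sup n delta <=
    (delta `^ (- (1 / 2)) *
       (1 + Num.sqrt (n%:R * (1 - delta) / delta)))%:E)%E.
Proof.
set B := _ * _.
have bound_le : Num.sqrt delta^-1 + Num.sqrt (n%:R * (1 - delta) / delta) <= B.
  rewrite /B mul1r powRN powR12_sqrt ?(ltW delta_gt0) // -sqrtrV ?(ltW delta_gt0) //.
  rewrite [leRHS]mulrDr mulr1 lerD2l.
  rewrite -[leLHS]mul1r ler_wpM2r ?sqrtr_ge0 // -[leLHS]sqrtr1 ler_wsqrtr //.
  by rewrite invf_ge1 // (ltW delta_lt1).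
apply: ge_ereal_sup => _ [sigma [phi [ssigma phi_on ->]]].
have B0 : 0 <= B by apply: le_trans bound_le; rewrite addr_ge0 ?sqrtr_ge0.
rewrite /Linfty_circle unlock; case: ifP => _; last by rewrite lee_fin.
apply/ess_supP/nearW => x; rewrite /= lee_fin.
apply: le_trans bound_le; rewrite ger0_norm; last first.
  by case: (_.[_]) => a b /=; exact: sqrtr_ge0.
exact: orthonormal_normc_le ssigma phi_on.
Qed.
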